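(* For any starting configuration $S$ (a multiset of $n\ge 2$ positive integers) and any integer $k\ge 0$, if Alice plays the greedy strategy (in each move, choose two sheets carrying the two smallest numbers), then the sum of the numbers after $k$ moves equals $opt(S,k)$.
   Context: One-player game: Alice has $n\ge2$ sheets of paper, each with a positive integer written on it. A move consists of choosing two sheets, with numbers $a$ and $b$, erasing them and writing $a+b$ on both sheets; this move is denoted $(a,b)$. The configuration is the multiset of the $n$ numbers on the sheets; the starting configuration is the initial multiset. $opt(S,k)$ denotes the smallest possible sum of the numbers on the sheets that Alice can achieve after performing exactly $k$ moves starting from configuration $S$. *)

(* Defs.v *)
From mathcomp Require Import all_boot.
From mathcomp Require Import finmap multiset.
From mathcomp Require Import boolp classical_sets.

Set Implicit Arguments.
Unset Strict Implicit.
Unset Printing Implicit Defensive.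

Local Open Scope mset_scope.

(* [mset a; b] counts multiplicity, so [can_move S a a] requires two sheets
   carrying [a]. *)
Definition can_move (S : {mset nat}) (a b : nat) : Prop := [mset a; b] `<=` S.

Definition play (S : {mset nat}) (a b : nat) : {mset nat} :=
  (S `\` [mset a; b]) `+` [mset a + b; a + b].

Definition two_smallest (S : {mset nat}) (a b : nat) : Prop :=
  forall x, x \in S `\` [mset a; b] -> a <= x /\ b <= x.

Definition move (S T : {mset nat}) : Prop :=
  exists a b, can_move S a b /\ T = play S a b.

Definition greedy_move (S T : {mset nat}) : Prop :=
  exists a b, [/\ can_move S a b, two_smallest S a b & T = play S a b].

Fixpoint after (step : {mset nat} -> {mset nat} -> Prop) (k : nat)
    (S T : {mset nat}) : Prop :=
  if k is k'.+1 then exists2 U, step S U & after step k' U T else T = S.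

Definition sheet_sum (S : {mset nat}) : nat := \sum_(x <- S) x.

Definition is_opt (S : {mset nat}) (k m : nat) : Prop :=
  (exists2 T, after move k S T & sheet_sum T = m) /\
  (forall T, after move k S T -> m <= sheet_sum T).

(* The default 0 is only used when no sequence of [k] moves exists, which is
   excluded by [opt_spec] for at least two sheets. *)
Definition opt (S : {mset nat}) (k : nat) : nat := xget 0 (is_opt S k).

Lemma perm_mset2 (S : {mset nat}) (a b : nat) (r : seq nat) :
  perm_eq S [:: a, b & r] ->
  [mset a; b] `<=` S /\ S `\` [mset a; b] = seq_mset r.
Proof.
move=> /permP pS.
have SE x : S x = (x == a) + (x == b) + count_mem x r.
  by rewrite -count_mem_mset pS /= addnA ![_ == x]eq_sym.
split.
  apply/msubsetP=> x; rewrite !msetE2 !msetnE SE.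
  by do 2 case: (_ == _); rewrite /= ?leq_addr.
apply/msetP=> x; rewrite !msetE2 !msetnE SE mset_seqE.
by do 2 case: (_ == _); rewrite /= ?add0n ?addn0 ?addKn ?subn0.
Qed.

Lemma size_play (S : {mset nat}) (a b : nat) :
  can_move S a b -> size (play S a b) = size S.
Proof.
move=> ab; have sD (A B : {mset nat}) : size (A `+` B) = size A + size B.
  rewrite -size_cat; apply/perm_size/allP => x _ /=.
  by apply/eqP; rewrite count_cat !count_mem_mset msetE2.
rewrite /play sD -[in RHS](msetBDK ab) !sD.
by rewrite !enum_msetn.
Qed.

Lemma greedy_move_ex (S : {mset nat}) :
  1 < size S -> exists2 T, greedy_move S T & size T = size S.
Proof.
move=> S2; have pS : perm_eq S (sort leq S) by rewrite perm_sym perm_sort.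
have := sort_sorted leq_total S; move: pS.
case: (sort leq S) => [|a [|b r]] pS; [by rewrite (perm_size pS) in S2 .. |].
rewrite (sorted_pairwise leq_trans) /= => /and3P[/andP[_ ar] br _].
have [sub eqr] := perm_mset2 pS.
exists (play S a b); last exact: size_play.
exists a, b; split=> // x; rewrite eqr (perm_mem (perm_eq_seq_mset r)) => xr.
by split; [exact: (allP ar) | exact: (allP br)].
Qed.

Lemma greedy_after_ex (S : {mset nat}) (k : nat) :
  1 < size S -> exists T, after greedy_move k S T.
Proof.
elim: k S => [|k IH] S S2; first by exists S.
have [U gU sU] := greedy_move_ex S2.
have [|T UT] := IH U; first by rewrite sU.
by exists T; exists U.
Qed.

Lemma greedy_after_move (S T : {mset nat}) (k : nat) :
  after greedy_move k S T -> after move k S T.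
Proof.
elim: k S => [//|k IH] S [U [a [b [ab _ UE]]] /IH UT].
by exists U => //; exists a, b.
Qed.

Lemma opt_spec (S : {mset nat}) (k : nat) :
  1 < size S -> is_opt S k (opt S k).
Proof.
move=> /(@greedy_after_ex _ k)[T0 /greedy_after_move ST0].
have ex : exists m, `[< exists2 T, after move k S T & sheet_sum T = m >].
  by exists (sheet_sum T0); apply/asboolP; exists T0.
apply: xgetPex; case: (ex_minnP ex) => m /asboolP mT minm.
by exists m; split=> // T ST; apply: minm; apply/asboolP; exists T.
Qed.

(* Main.v *)
Require Import Defs.
From mathcomp Require Import all_boot.
From mathcomp Require Import finmap multiset zify.

Local Open Scope mset_scope.

(** The sum after a fixed sequence of moves is a linear form with nonnegative
coefficients in the starting numbers, so the optimum is monotone and symmetric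
concave: replacing [p', p', q', q'] by [p, p, q, q], where [p + q = p' + q']
and [p] is at most both [p'] and [q'], cannot increase it.

By induction on the number of moves, it suffices to compare a first move
[(c, d)] followed by greedy moves with a sequence starting with the greedy move
[(a, b)].  If [(c, d)] uses neither sheet of [(a, b)], then [(a, b)] is the
next greedy move and the two moves commute.  If it is [(e, y)] with [e] one of
[a, b] and [e'] the other one, the next greedy move is [(e', z)] with [z] the
smallest remaining number.  When [z] is an original sheet, playing
[(e, e')], [(y, z)] instead gives a more spread out configuration with the same
sum; when [z = e + y], playing [(e, e')], [(e + e', y)] instead gives a
pointwise smaller one. *)

(** * Moves on explicit lists of sheets *)

Lemma play_seq_mset (a b : nat) (r : seq nat) :
  play (seq_mset [:: a, b & r]) a b = seq_mset [:: a + b, a + b & r].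
Proof.
have [_ eqr] := perm_mset2 (perm_eq_seq_mset [:: a, b & r]).
apply/msetP => x; rewrite /play eqr !msetE2 !msetnE !mset_seqE /= [_ == x]eq_sym.
by rewrite addnC addnA.
Qed.

Lemma can_move_seq_mset (S : {mset nat}) (a b : nat) :
  can_move S a b -> S = seq_mset [:: a, b & S `\` [mset a; b]].
Proof.
move=> /msubsetP ab; apply/msetP => x; move: (ab x).
rewrite mset_seqE /= count_mem_mset !msetE2 !msetnE [a == x]eq_sym [b == x]eq_sym.
by rewrite addnA => /subnKC.
Qed.

Lemma moveP (S T : {mset nat}) :
  move S T <-> exists a b r,
    S = seq_mset [:: a, b & r] /\ T = seq_mset [:: a + b, a + b & r].
Proof.
split=> [[a [b [/can_move_seq_mset SE ->]]]|[a [b [r [-> ->]]]]].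
  exists a, b, (S `\` [mset a; b]); split=> //.
  by rewrite [in LHS]SE play_seq_mset.
have [sub _] := perm_mset2 (perm_eq_seq_mset [:: a, b & r]).
by exists a, b; split=> //; rewrite play_seq_mset.
Qed.

Lemma greedy_moveP (S T : {mset nat}) :
  greedy_move S T <-> exists a b r,
    [/\ S = seq_mset [:: a, b & r], all (leq a) r, all (leq b) r &
        T = seq_mset [:: a + b, a + b & r]].
Proof.
split=> [[a [b [/can_move_seq_mset SE ab ->]]]|[a [b [r [-> ar br ->]]]]].
  exists a, b, (S `\` [mset a; b]); split=> //.
  - by apply/allP => x /ab[].
  - by apply/allP => x /ab[].
  - by rewrite [in LHS]SE play_seq_mset.
have [sub eqr] := perm_mset2 (perm_eq_seq_mset [:: a, b & r]).
exists a, b; split=> //; last by rewrite play_seq_mset.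
move=> x; rewrite eqr (perm_mem (perm_eq_seq_mset r)) => xr.
by split; [exact: (allP ar) | exact: (allP br)].
Qed.

Lemma sheet_sum_seq_mset (s : seq nat) : sheet_sum (seq_mset s) = \sum_(x <- s) x.
Proof. exact/perm_big/perm_eq_seq_mset. Qed.

(** * Linearity of the final sum in the starting numbers *)

Lemma perm_eq_map_inv (I T : eqType) (f : I -> T) (l : seq I) (s : seq T) :
  perm_eq s (map f l) -> exists2 l', perm_eq l' l & s = map f l'.
Proof.
case: l => [|i0 l].
  by move=> /perm_nilP ->; exists [::].
move=> /(perm_iotaP (f i0))[Is]; rewrite size_map => pI ->.
exists (map (nth i0 (i0 :: l)) Is).
  by have := perm_map (nth i0 (i0 :: l)) pI; rewrite map_nth_iota0 ?take_size.
rewrite -map_comp; apply/eq_in_map => i.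
by rewrite (perm_mem pI) mem_iota /= => li; rewrite -(nth_map i0 (f i0)).
Qed.

(** The coefficients form a function on all of [nat], so that removing the head of the list merely
    shifts them. *)
Definition coef_sum (c : nat -> nat) (s : seq nat) : nat :=
  \sum_(i < size s) c i * nth 0 s i.

Lemma coef_sum_cons (c : nat -> nat) (x : nat) (s : seq nat) :
  coef_sum c (x :: s) = c 0 * x + coef_sum (c \o succn) s.
Proof. by rewrite /coef_sum big_ord_recl. Qed.

(* A sequence of moves played on the sheets labelled by [l] can be replayed on
   any other numbering [g] of these sheets. *)
Lemma after_move_linear_map (I : eqType) (l : seq I) (k : nat) (f : I -> nat)
    (T : {mset nat}) :
  uniq l -> after move k (seq_mset (map f l)) T ->
  exists2 c : I -> nat, sheet_sum T = \sum_(i <- l) c i * f i &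
    forall g, exists2 T', after move k (seq_mset (map g l)) T' &
      sheet_sum T' = \sum_(i <- l) c i * g i.
Proof.
move=> Ul; elim: k f => [|k IH] f /=.
  have sumE g : sheet_sum (seq_mset (map g l)) = \sum_(i <- l) 1 * g i.
    by rewrite sheet_sum_seq_mset big_map; apply: eq_bigr => i _; rewrite mul1n.
  by move=> ->; exists (fun=> 1) => // g; exists (seq_mset (map g l)).
(* The move is given by numbers only; lifting the permutation to labels picks two distinct sheets
   [i] and [j] carrying them, even when numbers repeat. *)
case=> U /moveP[a [b [r [/esym/eq_seq_msetP/perm_eq_map_inv]]]].
case=> [[|i [|j l']] // pl [-> -> ->]] ->{U a b r}.
have := Ul; rewrite -(perm_uniq pl) /= inE negb_or -andbA.
case/and4P=> ij il' jl' _.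
pose upd h m := if (m == i) || (m == j) then h i + h j else h m.
have updl' (h : I -> nat) : {in l', upd h =1 h}.
  move=> m ml'; rewrite /upd; case: eqP => [mi|_]; first by rewrite -mi ml' in il'.
  by case: eqP => // mj; rewrite -mj ml' in jl'.
have updE (h : I -> nat) : seq_mset [:: h i + h j, h i + h j & map h l'] =
    seq_mset (map (upd h) l).
  apply/eq_seq_msetP; rewrite -(permPr (perm_map (upd h) pl)) /= /upd !eqxx orbT /=.
  by rewrite !perm_cons (_ : map (upd h) l' = map h l') //; exact/eq_in_map/updl'.
rewrite updE => /IH[c Tc cP].
(* The move is the linear map [upd], whose matrix is symmetric, so coefficients are pulled back
   along it by the same formula. *)
pose c' m := if (m == i) || (m == j) then c i + c j else c m.
have c'E (h : I -> nat) :
    \sum_(m <- l) c m * upd h m = \sum_(m <- l) c' m * h m.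
  rewrite -!(perm_big _ pl) /= !big_cons /upd /c' !eqxx !orbT /=.
  rewrite !addnA; congr (_ + _); first lia.
  apply: eq_big_seq => m ml'.
  case: eqP => [mi|_]; first by rewrite -mi ml' in il'.
  by case: eqP => // mj; rewrite -mj ml' in jl'.
exists c' => [|g]; first by rewrite Tc c'E.
have [T' gT' T'E] := cP (upd g); exists T'; last by rewrite T'E c'E.
exists (seq_mset (map (upd g) l)) => //; apply/moveP.
exists (g i), (g j), (map g l'); split; last by rewrite updE.
by apply/eq_seq_msetP; rewrite -(permPl (perm_map g pl)).
Qed.

Lemma after_move_linear (s : seq nat) (k : nat) (T : {mset nat}) :
  after move k (seq_mset s) T ->
  exists2 c : nat -> nat, sheet_sum T = coef_sum c s &
    forall t, size t = size s ->
      exists2 T', after move k (seq_mset t) T' & sheet_sum T' = coef_sum c t.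
Proof.
have sE t : map (nth 0 t) (iota 0 (size t)) = t by rewrite map_nth_iota0 ?take_size.
have cE (c : nat -> nat) t :
    \sum_(i <- iota 0 (size t)) c i * nth 0 t i = coef_sum c t.
  by rewrite -/(index_iota 0 _) -{1}[size t]subn0 big_mkord.
rewrite -{1}[s]sE => /(after_move_linear_map _ _ _ _ _ (iota_uniq _ _))[c Tc cP].
exists c => [|t ts]; first by rewrite Tc cE.
by have [T'] := cP (nth 0 t); rewrite -ts sE cE; exists T'.
Qed.

(** * Comparison of configurations under arbitrary play *)

Definition no_worse (k : nat) (S S' : {mset nat}) : Prop :=
  forall T', after move k S' T' ->
    exists2 T, after move k S T & sheet_sum T <= sheet_sum T'.

Lemma no_worse_refl (k : nat) (S : {mset nat}) : no_worse k S S.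
Proof. by move=> T ST; exists T. Qed.

Lemma no_worse_decrease (k x y : nat) (r : seq nat) :
  x <= y -> no_worse k (seq_mset (x :: r)) (seq_mset (y :: r)).
Proof.
move=> xy T' /after_move_linear[c T'c /(_ (x :: r) erefl)[T xT Tc]].
by exists T => //; rewrite T'c Tc !coef_sum_cons leq_add2r leq_mul2l xy orbT.
Qed.

(** The hypotheses force [p <= q]. The given moves can be replayed with the two pairs in either
    order; the order that puts [p] on the pair with the larger total coefficient does at least as
    well. *)
Lemma no_worse_spread (k p q p' q' : nat) (r : seq nat) :
  p + q = p' + q' -> p <= p' -> p <= q' ->
  no_worse k (seq_mset [:: p, p, q, q & r]) (seq_mset [:: p', p', q', q' & r]).
Proof.
move=> pq pp' pq' T' /after_move_linear[c T'c cP].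
have [T1 pT1 T1c] := cP [:: p, p, q, q & r] erefl.
have [T2 pT2 T2c] := cP [:: q, q, p, p & r] erefl.
move: T'c T1c T2c; rewrite !coef_sum_cons /=; set R := coef_sum _ r => T'c T1c T2c.
have [lec|lec] := leqP (c 2 + c 3) (c 0 + c 1).
  by exists T1 => //; rewrite T'c T1c; nia.
exists T2; last by rewrite T'c T2c; nia.
suff -> : seq_mset [:: p, p, q, q & r] = seq_mset [:: q, q, p, p & r] by [].
by apply/eq_seq_msetP; rewrite (perm_catCA [:: p; p] [:: q; q] r).
Qed.

(** * Exchange of the first two moves *)

Lemma perm_cons_cons (I : eqType) (x y : I) (s t : seq I) :
  perm_eq (x :: s) (y :: t) ->
  x = y /\ perm_eq s t \/ exists2 u, perm_eq s (y :: u) & perm_eq t (x :: u).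
Proof.
have [-> |xy] := eqVneq x y; first by rewrite perm_cons; left.
move=> pst; have ys : y \in s.
  by have := perm_mem pst y; rewrite !inE eqxx eq_sym (negPf xy).
right; exists (rem y s); first exact: perm_to_rem.
rewrite -(perm_cons y) -(permPl pst) perm_sym (perm_catCA [:: y] [:: x]) /=.
by rewrite perm_cons perm_sym perm_to_rem.
Qed.

Lemma seq_min_split (x : nat) (r : seq nat) :
  all (leq x) r \/
  exists z t, [/\ perm_eq r (z :: t), all (leq z) t & z <= x].
Proof.
have [|/allPn[y yr]] := boolP (all (leq x) r); first by left.
rewrite -ltnNge => yx; right.
have pr : perm_eq r (sort leq r) by rewrite perm_sym perm_sort.
have := sort_sorted leq_total r; move: pr.
case: (sort leq r) => [/perm_nilP r0 | z t pr]; first by rewrite r0 in yr.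
rewrite (sorted_pairwise leq_trans) /= => /andP[zt _].
exists z, t; split=> //; apply: leq_trans (ltnW yx).
by move: yr; rewrite (perm_mem pr) inE => /predU1P[-> // | /(allP zt)].
Qed.

Lemma exchange_one_common (e e' y : nat) (r : seq nat) :
  all (leq e) (y :: r) -> all (leq e') (y :: r) ->
  let U := seq_mset [:: e + e', e + e', y & r] in
  let V := seq_mset [:: e + y, e + y, e' & r] in
  sheet_sum U <= sheet_sum V /\ exists W W0,
    [/\ greedy_move V W, move U W0 & forall k, no_worse k W0 W].
Proof.
move=> /= /andP[ey er] /andP[e'y e'r].
split; first by rewrite !sheet_sum_seq_mset !big_cons; lia.
(* In [V] the number [e'] is smallest, so the greedy reply depends on whether [e + y] or an entry
   [z] of [r] comes next. *)
have [r_ge|[z [t [prz tz zey]]]] := seq_min_split (e + y) r.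
  exists (seq_mset [:: e' + (e + y), e' + (e + y), e + y & r]).
  exists (seq_mset [:: e + e' + y, e + e' + y, e + e' & r]); split.
  - apply/greedy_moveP; exists e', (e + y), (e + y :: r); split=> //=.
    + by apply/eq_seq_msetP; rewrite (perm_catCA [:: e + y; e + y] [:: e'] r).
    + by rewrite e'r andbT; lia.
    + by rewrite leqnn.
  - apply/moveP; exists (e + e'), y, (e + e' :: r); split=> //.
    by apply/eq_seq_msetP; rewrite perm_cons (perm_catCA [:: e + e'] [:: y] r).
  (* The two results differ on one sheet only, [e + e'] against [e + y]. *)
  move=> k; rewrite (_ : e' + (e + y) = e + e' + y); last lia.
  set x := e + e' + y.
  have rot u : seq_mset [:: x, x, u & r] = seq_mset [:: u, x, x & r].
    by apply/eq_seq_msetP; rewrite (perm_catCA [:: x; x] [:: u] r).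
  by rewrite !rot; apply: no_worse_decrease; rewrite leq_add2l.
have rE s : seq_mset (s ++ r) = seq_mset (s ++ z :: t).
  by apply/eq_seq_msetP; rewrite perm_cat2l.
move: er e'r; rewrite !(perm_all _ prz) /= => /andP[ez et] /andP[e'z e't].
exists (seq_mset [:: e + y, e + y, e' + z, e' + z & t]).
exists (seq_mset [:: e + e', e + e', y + z, y + z & t]); split.
- apply/greedy_moveP; exists e', z, [:: e + y, e + y & t]; split.
  + rewrite (rE [:: e + y; e + y; e']); apply/eq_seq_msetP.
    by rewrite (perm_catCA [:: e + y; e + y] [:: e'; z] t).
  + by rewrite /= e't; lia.
  + by rewrite /= zey.
  + apply/eq_seq_msetP.
    by rewrite (perm_catCA [:: e + y; e + y] [:: e' + z; e' + z] t).
- apply/moveP; exists y, z, [:: e + e', e + e' & t]; split.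
  + rewrite (rE [:: e + e'; e + e'; y]); apply/eq_seq_msetP.
    by rewrite (perm_catCA [:: e + e'; e + e'] [:: y; z] t).
  + apply/eq_seq_msetP.
    by rewrite (perm_catCA [:: e + e'; e + e'] [:: y + z; y + z] t).
(* Here [e + e'] is at most [e + y] because [e' <= y], and at most [e' + z] because [e <= z]. *)
by move=> k; apply: no_worse_spread; lia.
Qed.

(** The reply [W] must be greedy, so that induction from [V] applies to it; [W0] may be any move,
    since induction from [U] beats all of them. The bare inequality of sums serves when no move
    remains. *)
Lemma greedy_exchange (S U V : {mset nat}) :
  greedy_move S U -> move S V ->
  U = V \/ sheet_sum U <= sheet_sum V /\ exists W W0,
    [/\ greedy_move V W, move U W0 & forall k, no_worse k W0 W].
Proof.
case/greedy_moveP=> a [b [r [-> ar br ->]]] /moveP[c [d [r' [/eq_seq_msetP]]]].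
rewrite perm_sym => p ->.
(* Exactly one shared sheet: [e] is in both moves, [e'] only in the greedy one, [y] only in the
   other, and [u] is untouched. *)
have common e e' y u : all (leq e) r -> all (leq e') r -> e + e' = a + b ->
    e + y = c + d -> perm_eq r (y :: u) -> perm_eq r' (e' :: u) ->
    let U := seq_mset [:: a + b, a + b & r] in
    let V := seq_mset [:: c + d, c + d & r'] in
    sheet_sum U <= sheet_sum V /\ exists W W0,
      [/\ greedy_move V W, move U W0 & forall k, no_worse k W0 W].
  move=> er e'r <- <- ru r'u /=.
  have /eq_seq_msetP -> : perm_eq [:: e + y, e + y & r'] [:: e + y, e + y, e' & u].
    by rewrite !perm_cons.
  have /eq_seq_msetP -> :
      perm_eq [:: e + e', e + e' & r] [:: e + e', e + e', y & u].
    by rewrite !perm_cons.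
  by apply: exchange_one_common; rewrite -(perm_all _ ru).
have same x : perm_eq r r' -> seq_mset [:: x, x & r] = seq_mset [:: x, x & r'].
  by move=> rr'; apply/eq_seq_msetP; rewrite !perm_cons.
(* Split by which of the sheets [c], [d] are matched with [a], [b]. *)
case: (perm_cons_cons _ _ _ _ _ p) => [[ca /perm_cons_cons[[db rr']|[u r'u ru]]]|].
- by left; rewrite ca db; apply: same; rewrite perm_sym.
- by right; apply: (common a b d u) => //; rewrite ca.
case=> u /perm_cons_cons[[da r'u]|[v r'v uv]] /perm_cons_cons[[bc ru]|[w rw uw]].
- left; rewrite -bc da addnC; apply: same.
  by rewrite (permPl ru) perm_sym.
- right; apply: (common a b c w) => //; first by rewrite da addnC.
  by rewrite (permPl r'u).
- right; apply: (common b a d v) => //; [by rewrite addnC | by rewrite bc |].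
  by rewrite (permPl ru).
have : perm_eq (d :: v) (b :: w) by rewrite -(permPl uv).
case/perm_cons_cons=> [[db vw]|[x vx wx]]; right.
  apply: (common b a c w) => //; [by rewrite addnC | by rewrite db addnC |].
  by rewrite (permPl r'v) perm_cons.
(* No shared sheet: the moves commute, and both orders end in the same configuration. *)
have rE : perm_eq r [:: c, d & x] by rewrite (permPl rw) perm_cons.
have r'E : perm_eq r' [:: a, b & x] by rewrite (permPl r'v) perm_cons.
move: ar br; rewrite !(perm_all _ rE) /= => /and3P[ac ad ax] /and3P[bc bd bx].
split.
  rewrite !sheet_sum_seq_mset !big_cons (perm_big _ rE) (perm_big _ r'E) /=.
  by rewrite !big_cons; lia.
exists (seq_mset [:: a + b, a + b, c + d, c + d & x]).
exists (seq_mset [:: a + b, a + b, c + d, c + d & x]); split.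
- apply/greedy_moveP; exists a, b, [:: c + d, c + d & x].
  split=> //=; [|by rewrite ax; lia|by rewrite bx; lia].
  apply/eq_seq_msetP; rewrite perm_sym (perm_catCA [:: a; b] [:: c + d; c + d] x).
  by rewrite /= !perm_cons perm_sym.
- apply/moveP; exists c, d, [:: a + b, a + b & x]; split.
    apply/eq_seq_msetP.
    rewrite perm_sym (perm_catCA [:: c; d] [:: a + b; a + b] x).
    by rewrite /= !perm_cons perm_sym.
  apply/eq_seq_msetP.
  by rewrite (perm_catCA [:: a + b; a + b] [:: c + d; c + d] x).
by move=> k; apply: no_worse_refl.
Qed.

(** * Optimality of greedy play *)

Lemma size_move (S T : {mset nat}) : move S T -> size T = size S.
Proof. by case=> a [b [ab ->]]; apply: size_play. Qed.

Lemma greedy_after_min (k : nat) (S T T' : {mset nat}) :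
  1 < size S -> after greedy_move k S T -> after move k S T' ->
  sheet_sum T <= sheet_sum T'.
Proof.
elim: k S T T' => [|k IH] S T T' S2; first by move=> -> ->.
case=> U SU UT [V SV VT'].
have sV : 1 < size V by rewrite (size_move _ _ SV).
have sU : 1 < size U.
  by case: SU => a [b [ab _ ->]]; rewrite size_play.
have [UV|[sUV [W [W0 [VW UW0 W0W]]]]] := greedy_exchange _ _ _ SU SV.
  by apply: IH UT _ => //; rewrite UV.
case: k IH UT VT' => [|k] IH UT VT'.
  by move: UT VT' => /= -> ->.
have sW : 1 < size W.
  by case: VW => a [b [ab _ ->]]; rewrite size_play.
(* [T1] continues greedily from [W], and [T0] is a play from [W0] at least as good. The sums
   increase along [T], [T0], [T1], [T']: the outer steps are induction at [U] and at [V]. *)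
have [T1 WT1] := greedy_after_ex k sW.
have T1T' : sheet_sum T1 <= sheet_sum T'.
  by apply: (IH V) => //; exists W.
have [T0 W0T0 T0T1] := W0W k _ (greedy_after_move WT1).
apply: leq_trans T1T'; apply: leq_trans T0T1.
by apply: (IH U) => //; exists W0.
Qed.

Theorem theorem4 (S : {mset nat}) (k : nat) (T : {mset nat})
    (S_size : 2 <= size S) (S_pos : forall x : nat, x \in S -> 0 < x)
    (S_T : after greedy_move k S T) :
  sheet_sum T = opt S k.
Proof.
have [[T0 ST0 <-] minS] := opt_spec k S_size.
apply/eqP; rewrite eqn_leq (greedy_after_min k S) //=.
exact/minS/greedy_after_move.
Qed.
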